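(* Let $N\ge 1$ be an integer, let $S=\{\lambda_j\}_{j=1}^N$ be a set of distinct real numbers, and let $\{\theta_j\}_{j=1}^N\subset[0,\pi)$ be a set of angles (not necessarily distinct). Then there exist a constant $M>0$ (depending on $S$) and real-valued $C^\infty$ potentials $p,q\in L^2[0,\infty)$ satisfying $$\sqrt{p(x)^2+q(x)^2}\le\frac{M}{1+x}\qquad\text{for all }x\ge 0,$$ such that for each $j=1,\dots,N$ the equation $$L_{p,q}\begin{pmatrix}u\\ v\end{pmatrix}=\lambda_j\begin{pmatrix}u\\ v\end{pmatrix}$$ has a nontrivial solution $(u_j,v_j)^T\in L^2[0,\infty)\bigoplus L^2[0,\infty)$ satisfying the boundary condition $$\frac{u_j(0)}{v_j(0)}=\cot\theta_j .$$
   Context: For real-valued functions $p,q\in L^2[0,\infty)$ (called potentials), the Dirac operator in canonical form is $$L_{p,q}\begin{pmatrix}u\\ v\end{pmatrix}=\begin{pmatrix}0&-1\\1&0\end{pmatrix}\frac{d}{dx}\begin{pmatrix}u\\ v\end{pmatrix}+\begin{pmatrix}-p&q\\ q&p\end{pmatrix}\begin{pmatrix}u\\ v\end{pmatrix}$$ on $[0,\infty)$. The potential is called $C^\infty$ if both $p$ and $q$ are $C^\infty$ on $[0,\infty)$. The boundary condition $\frac{u(0)}{v(0)}=\cot\theta_j$ means $u(0)\sin\theta_j-v(0)\cos\theta_j=0$; in particular for $\theta_j=0$ it means $v(0)=0$. *)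

(* Defs.v *)
From HB Require Import structures.
From mathcomp Require Import all_boot all_order all_algebra.
From mathcomp Require Import all_classical all_reals all_analysis.

Set Implicit Arguments.
Unset Strict Implicit.
Unset Printing Implicit Defensive.

Import Order.TTheory GRing.Theory Num.Theory.
Import numFieldNormedType.Exports.

Local Open Scope classical_set_scope.
Local Open Scope ring_scope.

(* Functions on [0,oo) are represented by total functions R -> R whose values
   at negative arguments are ignored: every notion below, and in particular
   differentiability, is relative to [0,oo) (so it is one-sided at 0). *)
Definition halfline (R : realType) : set R := [set x | 0 <= x].

Definition hl_quotient (R : realType) (f : R -> R) (x y : R) : R :=
  (f y - f x) / (y - x).

Definition hl_derivable (R : realType) (f : R -> R) (x : R) : Prop :=
  cvg (hl_quotient f x y @[y --> within (@halfline R) x^']).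

Definition hl_derive (R : realType) (f : R -> R) (x : R) : R :=
  lim (hl_quotient f x y @[y --> within (@halfline R) x^']).

Definition hl_differentiable (R : realType) (f : R -> R) : Prop :=
  forall x, 0 <= x -> hl_derivable f x.

Definition hl_smooth (R : realType) (f : R -> R) : Prop :=
  forall n : nat, hl_differentiable (iter n (@hl_derive R) f).

(* [f \_ D] is the extension by zero of the restriction of [f] to [D]. *)
Definition hl_L2 (R : realType) (f : R -> R) : Prop :=
  f \_ (@halfline R) \in Lfun (@lebesgue_measure R) 2%:E.

(* The two components of L_{p,q} (u, v)^T, with
   L_{p,q} = [0, -1; 1, 0] d/dx + [-p, q; q, p]. *)
Definition dirac_op (R : realType) (p q u v : R -> R) (x : R) : R * R :=
  (- hl_derive v x - p x * u x + q x * v x,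
   hl_derive u x + q x * u x + p x * v x).

(* (u, v) is a nontrivial classical solution of L_{p,q} (u, v) = l (u, v). *)
Definition dirac_eigensolution (R : realType) (p q : R -> R) (l : R)
    (u v : R -> R) : Prop :=
  [/\ hl_differentiable u, hl_differentiable v,
      forall x, 0 <= x -> dirac_op p q u v x = (l * u x, l * v x)
    & exists2 x, 0 <= x & (u x, v x) != (0, 0)].

(* u(0)/v(0) = cot theta; for theta = 0 it reads v(0) = 0. *)
Definition boundary_cond (R : realType) (theta : R) (u v : R -> R) : Prop :=
  u 0 * sin theta - v 0 * cos theta = 0.

(* Main.v *)
Require Import Defs.
From HB Require Import structures.
From mathcomp Require Import all_boot all_order all_algebra.
From mathcomp Require Import all_classical all_reals all_analysis.
From mathcomp Require Import perm measurable_realfun.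
From mathcomp Require Import ring lra.

Set Implicit Arguments.
Unset Strict Implicit.
Unset Printing Implicit Defensive.

Import Order.TTheory GRing.Theory Num.Theory.
Import numFieldNormedType.Exports.

Local Open Scope classical_set_scope.
Local Open Scope ring_scope.

(** The eigenvalues are inserted into the free operator by the double
    commutation (Gelfand-Levitan) transformation.  Let [phi_j = (u_j, v_j)] be
    solutions of [J phi_j' = lambda_j phi_j], [J = [0, -1; 1, 0]], with
    [|phi_j| = 1], and let [G]
    be a symmetric matrix function with [G' = Phi^T Phi] and
    [G L - L G = Phi^T J Phi], where [Phi] has columns [phi_j] and [L] is the
    diagonal matrix of the [lambda_j].  Then [Psi = Phi G^-1] satisfies
    [J Psi' + Q Psi = Psi L] with [Q = J K - K J] and [K = Phi G^-1 Phi^T]; [Q] is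
    symmetric and traceless, hence a Dirac potential ([eig_ode]).  Since the
    free solutions are trigonometric, [G] is explicit: its off-diagonal entries
    are the Wronskians of [phi_i] and [phi_j] divided by [lambda_j - lambda_i],
    hence bounded, and its diagonal entries are [D_j + x] with [D_j] free.

    If every [D_j] is at least a constant depending only on the eigenvalues, [G x]
    is diagonally dominant with margin [1 + x], so that the entries of [G^-1]
    are at most [1 / (1 + x)] ([diag_dominant_invmx]).  This bounds [Q] and [Psi]
    by a multiple of [1 / (1 + x)], which gives square integrability; the
    constant does not see the phases of the [phi_j] nor the [D_j], whence the
    uniformity of the bound in the boundary conditions.  Smoothness holds
    because [Phi] and [Psi] together solve an autonomous polynomial system of
    differential equations ([polynomial_in_hl_smooth]).

    It remains to choose the phases and the [D_j] so that [Psi 0] has columns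
    proportional to [(cos theta_j, sin theta_j)].  Call [E] the matrix with these
    columns.  The relation between [G 0] and [Phi 0] becomes linear for the
    inverse [B] of [G 0]: [L B - B L = E^T J E].  It determines [B] off the
    diagonal and leaves the diagonal free.  Taking a large constant [d] on the
    diagonal makes [d B^-1] close to the identity, and the columns of [E B^-1],
    once normalised, are the initial values needed ([prescribed_boundary]). *)

(** * Calculus on the half-line *)

(** Every point of the half-line, [0] included, is an accumulation point, so that
    limits along this filter are unique. *)
Lemma halfline_dnbhs_proper (R : realType) (x : R) :
  0 <= x -> ProperFilter (within (@halfline R) x^').
Proof.
move=> x0; apply: Build_ProperFilter_ex => P.
rewrite /within/= => /nbhs_ballP[e /= e0 Pe].
exists (x + e / 2); apply: Pe.
- rewrite /ball/= opprD addrA subrr add0r normrN gtr0_norm; lra.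
- by rewrite -subr_eq0 addrAC subrr add0r gt_eqF// divr_gt0.
- by rewrite /halfline/= addr_ge0// ltW// divr_gt0.
Qed.

Lemma is_derive_hl_quotient (R : realType) (f : R -> R) (x l : R) :
  is_derive x 1 f l ->
  hl_quotient f x y @[y --> within (@halfline R) x^'] --> l.
Proof.
case=> /cvg_ex[/= l' fl'] ll'.
have {ll' l'}fl' : h^-1 *: (f (h *: 1 + x) - f x) @[h --> 0^'] --> l.
  by rewrite -ll' /derive (cvg_lim _ fl').
apply/cvgrPdist_le => e e0.
move/cvgrPdist_le : fl' => /(_ _ e0).
rewrite /dnbhs !near_withinE => /nbhs_ballP[d /= d0 de].
apply/nbhs_ballP; exists d => //= y xy yx y0.
have -> : hl_quotient f x y = (y - x)^-1 *: (f ((y - x) *: 1 + x) - f x).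
  by rewrite /hl_quotient /GRing.scale/= mulr1 subrK mulrC.
apply: de; last by rewrite subr_eq0.
by move: xy; rewrite /ball/= sub0r opprB.
Qed.

Lemma is_derive_hl (R : realType) (f : R -> R) (x l : R) :
  0 <= x -> is_derive x 1 f l -> hl_derivable f x /\ hl_derive f x = l.
Proof.
move=> x0 /is_derive_hl_quotient fl; have FF := halfline_dnbhs_proper x0.
by split; [apply/cvg_ex; exists l | exact/cvg_lim].
Qed.

Lemma eq_hl_derive (R : realType) (f g : R -> R) (x : R) : 0 <= x ->
  (forall y, 0 <= y -> f y = g y) ->
  (hl_derivable f x -> hl_derivable g x) /\ hl_derive f x = hl_derive g x.
Proof.
move=> x0 fg.
have E : hl_quotient f x y @[y --> within (@halfline R) x^'] =
         hl_quotient g x y @[y --> within (@halfline R) x^'].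
  have fg' y : 0 <= y -> hl_quotient f x y = hl_quotient g x y.
    by move=> y0; rewrite /hl_quotient (fg x x0) (fg y y0).
  apply/seteqP; split=> A; rewrite /nbhs/= /within/= !near_withinE => nA;
    apply: filterS nA => y h yx y0.
  - by have := h yx y0; rewrite (fg' y y0).
  - by have := h yx y0; rewrite -(fg' y y0).
by rewrite /hl_derivable /hl_derive E.
Qed.

Inductive polynomial_in (R : realType) (I : Type) (g : I -> R -> R) :
    (R -> R) -> Prop :=
| PolyCst c : polynomial_in g (fun=> c)
| PolyVar i : polynomial_in g (g i)
| PolyAdd f1 f2 : polynomial_in g f1 -> polynomial_in g f2 ->
    polynomial_in g (fun x => f1 x + f2 x)
| PolyMul f1 f2 : polynomial_in g f1 -> polynomial_in g f2 ->
    polynomial_in g (fun x => f1 x * f2 x).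

Lemma polynomial_in_sub (R : realType) (I : Type) (g : I -> R -> R)
    (f1 f2 : R -> R) : polynomial_in g f1 -> polynomial_in g f2 ->
  polynomial_in g (fun x => f1 x - f2 x).
Proof.
move=> P1 P2; under eq_fun do rewrite -mulN1r.
by apply: PolyAdd => //; apply: PolyMul => //; exact: PolyCst.
Qed.

Lemma polynomial_in_sum (R : realType) (I : Type) (g : I -> R -> R) n
    (f : 'I_n -> R -> R) :
  (forall i, polynomial_in g (f i)) ->
  polynomial_in g (fun x => \sum_i f i x).
Proof.
move=> fP; elim: n f fP => [|n IH] f fP.
  under eq_fun do rewrite big_ord0; exact: PolyCst.
by under eq_fun do rewrite big_ord_recr /=; apply: PolyAdd; [exact: IH|].
Qed.

Lemma is_derive_mul (R : realType) (f g : R -> R) (x a b : R) :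
  is_derive x 1 f a -> is_derive x 1 g b ->
  is_derive x 1 (fun y => f y * g y) (a * g x + f x * b).
Proof.
move=> df dg; have := is_deriveM df dg; rewrite /GRing.scale/= => h.
by apply: is_derive_eq h _; rewrite addrC mulrC.
Qed.

Lemma polynomial_in_derive (R : realType) (I : Type) (g : I -> R -> R) :
  (forall i, exists2 dg, polynomial_in g dg &
     forall x : R, 0 <= x -> is_derive x 1 (g i) (dg x)) ->
  forall f, polynomial_in g f -> exists2 df, polynomial_in g df &
     forall x : R, 0 <= x -> is_derive x 1 f (df x).
Proof.
move=> dg f; elim=> [c|i|f1 f2 P1 [d1 Q1 h1] P2 [d2 Q2 h2]
  |f1 f2 P1 [d1 Q1 h1] P2 [d2 Q2 h2]]; last 2 first.
- exists (fun x => d1 x + d2 x) => [|x x0]; first exact: PolyAdd.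
  exact: is_deriveD (h1 x x0) (h2 x x0).
- exists (fun x => d1 x * f2 x + f1 x * d2 x) => [|x x0].
    by apply: PolyAdd; exact: PolyMul.
  exact: is_derive_mul (h1 x x0) (h2 x x0).
- exists (fun=> 0) => [|x _]; [exact: PolyCst | exact: is_derive_cst].
- exact: dg.
Qed.

(** A solution of an autonomous polynomial system of differential equations is
    smooth: derivation maps the algebra generated by the unknowns to itself, so
    it can be iterated.  The iterated one-sided derivatives agree with elements
    of this algebra on the half-line only, which is all that the next
    derivative sees. *)
Lemma polynomial_in_hl_smooth (R : realType) (I : Type) (g : I -> R -> R) :
  (forall i, exists2 dg, polynomial_in g dg &
     forall x : R, 0 <= x -> is_derive x 1 (g i) (dg x)) ->
  forall f, polynomial_in g f -> hl_smooth f.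
Proof.
move=> dg f fP n.
suff [h hP fh] : exists2 h, polynomial_in g h &
    forall y, 0 <= y -> iter n (@hl_derive R) f y = h y.
  move=> x x0; have [dh _ hdh] := polynomial_in_derive dg hP.
  have [hD _] := is_derive_hl x0 (hdh x x0).
  have fh' y : 0 <= y -> h y = iter n (@hl_derive R) f y by move/fh.
  by case: (eq_hl_derive x0 fh') => + _; apply.
elim: n => [|n [h hP fh]]; first by exists f.
have [dh dhP hdh] := polynomial_in_derive dg hP.
exists dh => // y y0; rewrite iterS.
have [_ ->] := eq_hl_derive y0 fh.
by have [_ ->] := is_derive_hl y0 (hdh y y0).
Qed.

Lemma halfline_itv (R : realType) : @halfline R = `[0, +oo[%classic.
Proof. by apply/seteqP; split=> x /=; rewrite in_itv/= andbT. Qed.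

Lemma is_derive_1D (R : realType) (x : R) :
  is_derive x 1 (fun y : R => 1 + y) 1.
Proof.
have := is_deriveD (is_derive_cst (1 : R) x 1) (is_derive_id x 1).
by rewrite add0r.
Qed.

Lemma is_derive_inv1D (R : realType) (x : R) : 0 <= x ->
  is_derive x 1 (fun y : R => - (1 + y)^-1) ((1 + x) ^- 2).
Proof.
move=> x0.
have n0 : 1 + x != 0 by rewrite gt_eqF// ltr_pwDl.
have d1 := is_derive_1D x.
have d2 := @deriveV _ _ (fun y : R => 1 + y) x 1 n0 (@ex_derive _ _ _ _ _ _ _ d1).
have d3 := @derivableV _ _ (fun y : R => 1 + y) x 1 n0 (@ex_derive _ _ _ _ _ _ _ d1).
apply: DeriveDef; first exact: derivableN.
by rewrite deriveN// d2 derive_val scaleNr opprK /GRing.scale/= mulr1.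
Qed.

Lemma continuous_inv_sqr1D (R : realType) :
  {within `[0, +oo[, continuous (fun x : R => (1 + x) ^- 2)}.
Proof.
apply: derivable_within_continuous => x; rewrite in_itv/= andbT => x0.
apply: derivableV; first by rewrite expf_neq0// gt_eqF// ltr_pwDl.
under eq_fun do rewrite expr2.
have d := is_derive_mul (is_derive_1D x) (is_derive_1D x).
exact: (@ex_derive _ _ _ _ _ _ _ d).
Qed.

Lemma integral_inv_sqr1D (R : realType) :
  (\int[@lebesgue_measure R]_(x in `[0%R, +oo[) ((1 + x) ^- 2)%:E = 1%:E)%E.
Proof.
rewrite (@ge0_continuous_FTC2y R (fun x => (1 + x) ^- 2) (fun x => - (1 + x)^-1) 0 0).
- by rewrite addr0 invr1 sub0e EFinN oppeK.
- by move=> x x0; rewrite invr_ge0 sqr_ge0.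
- exact: continuous_inv_sqr1D.
- rewrite -oppr0; apply: cvgN; apply/gtr0_cvgV0.
    near=> x; rewrite ltr_pwDl//; near: x; exact: nbhs_pinfty_ge.
  exact: cvg_addrl.
- by move=> x /ltW/is_derive_inv1D d; exact: (@ex_derive _ _ _ _ _ _ _ d).
- apply: cvg_at_right_filter; apply: cvgN; apply: cvgV.
    by rewrite addr0 oner_eq0.
  by apply: cvgD; [exact: cvg_cst|exact: cvg_id].
- move=> x; rewrite in_itv/= andbT => /ltW/is_derive_inv1D dx.
  by rewrite derive1E derive_val.
Unshelve. all: by end_near. Qed.

(** The derivative serves only to make [f] measurable; integrability of the
    square comes from comparison with [C ^+ 2 / (1 + x) ^+ 2]. *)
Lemma hl_L2_decay (R : realType) (f df : R -> R) (C : R) :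
  (forall x : R, 0 <= x -> is_derive x 1 f (df x)) ->
  (forall x, 0 <= x -> `|f x| <= C / (1 + x)) -> hl_L2 f.
Proof.
move=> fd fC.
have mI : measurable (`[0, +oo[%classic : set R) by exact: measurable_itv.
have mg : measurable_fun (`[0, +oo[%classic : set R) (fun x => (1 + x) ^- 2).
  apply: subspace_continuous_measurable_fun => //; exact: continuous_inv_sqr1D.
have mf : measurable_fun (`[0, +oo[%classic : set R) f.
  apply: subspace_continuous_measurable_fun => //.
  apply: derivable_within_continuous => x; rewrite in_itv/= andbT => x0.
  exact: (@ex_derive _ _ _ _ _ _ _ (fd x x0)).
have mf' : measurable_fun setT (f \_ (`[0, +oo[%classic : set R)).
  by apply/(measurable_restrictT _ _).1.
rewrite /hl_L2 halfline_itv inE; apply/andP; split; rewrite inE//=.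
rewrite /finite_norm unlock /=.
apply: poweR_lty.
have E x : ((`|(f \_ (`[0, +oo[%classic : set R)) x| `^ 2)%R%:E =
   ((fun x => (f x ^+ 2)%:E) \_ (`[0%R, +oo[%classic : set R)) x)%E.
  rewrite !patchE; case: ifPn => _ /=; first by rewrite powR_mulrn// real_normK// num_real.
  by rewrite normr0 powR0// pnatr_eq0.
under eq_integral do rewrite E.
rewrite -integral_mkcond.
apply: (@le_lt_trans _ _ (\int[lebesgue_measure]_(x in `[0%R, +oo[)
   ((C ^+ 2)%:E * ((1 + x) ^- 2)%:E))%E).
  apply: ge0_le_integral => //=.
  - by move=> x _; rewrite lee_fin sqr_ge0.
  - apply/measurable_EFinP; exact: measurable_funX.
  - by apply: measurable_funeM; exact/measurable_EFinP.
  - move=> x; rewrite in_itv/= andbT => x0.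
    rewrite -EFinM lee_fin -exprVn -exprMn -(real_normK (num_real (f x))).
    rewrite lerXn2r ?nnegrE ?fC//.
    by apply: le_trans (fC x x0); exact: normr_ge0.
rewrite ge0_integralZl_EFin ?sqr_ge0//=.
- by rewrite integral_inv_sqr1D mule1 ltry.
- by move=> x _; rewrite lee_fin invr_ge0 sqr_ge0.
- exact/measurable_EFinP.
Qed.

(** * Diagonally dominant matrices *)

(** The maximum principle for diagonally dominant matrices: at an index where
    [`|w 0 i|] is maximal, the diagonal term of [w *m G] outweighs all the others
    by at least [c] times this maximum. *)
Lemma diag_dominant_bound (R : realFieldType) n (G : 'M[R]_n) (w : 'rV[R]_n)
    (c b : R) : 0 <= c ->
  (forall k, c + \sum_(i | i != k) `|G i k| <= G k k) ->
  (forall k, `|(w *m G) 0 k| <= b) ->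
  forall k, c * `|w 0 k| <= b.
Proof.
move=> c0 dom wb k.
pose m := [arg max_(i > k) `|w 0 i|]%O.
have mmax i : `|w 0 i| <= `|w 0 m|.
  by rewrite /m; case: arg_maxP => // j _; apply.
apply: (le_trans _ (wb m)).
apply: (@le_trans _ _ (`|w 0 m| * c)); first by rewrite mulrC ler_wpM2r.
have wGm : (w *m G) 0 m = w 0 m * G m m + \sum_(i | i != m) w 0 i * G i m.
  by rewrite mxE (bigD1 m).
rewrite wGm.
apply: le_trans (lerB_normD _ _).
rewrite normrM lerBrDr.
apply: le_trans (_ : `|w 0 m| * G m m <= _); last first.
  by rewrite ler_wpM2l// ler_norm.
apply: le_trans (ler_wpM2l (normr_ge0 (w 0 m)) (dom m)).
rewrite mulrDr lerD2l mulr_sumr.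
apply: le_trans (ler_norm_sum _ _ _) _.
by apply: ler_sum => i _; rewrite normrM ler_wpM2r.
Qed.

Lemma diag_dominant_unitmx (R : realFieldType) n (G : 'M[R]_n) (c : R) :
  0 < c -> (forall k, c + \sum_(i | i != k) `|G i k| <= G k k) ->
  G \in unitmx.
Proof.
move=> c0 dom; rewrite -row_free_unit; apply: inj_row_free => w wG0.
apply/rowP => k; rewrite mxE.
have := @diag_dominant_bound _ _ _ w c 0 (ltW c0) dom.
have h0 i : `|(w *m G) 0 i| <= 0 by rewrite wG0 mxE normr0.
move=> /(_ h0 k); rewrite pmulr_rle0// normr_le0 => /eqP //.
Qed.

Lemma diag_dominant_invmx (R : realFieldType) n (G : 'M[R]_n) (c : R) :
  0 < c -> (forall k, c + \sum_(i | i != k) `|G i k| <= G k k) ->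
  forall i k, `|invmx G i k| <= c^-1.
Proof.
move=> c0 dom i k.
have h j : `|(row i (invmx G) *m G) 0 j| <= 1.
  rewrite -row_mul mulVmx ?(diag_dominant_unitmx c0 dom)// !mxE.
  by case: (_ == _); rewrite ?normr1 ?normr0.
have := diag_dominant_bound (ltW c0) dom h k; rewrite mxE => ck.
by rewrite -[leRHS]mulr1 ler_pdivlMl.
Qed.

(** * Derivative of the solution of a linear system *)

Lemma is_derive_bigsum (R : realType) (I : Type) (r : seq I) (P : pred I)
    (f : I -> R -> R) (df : I -> R) (x : R) :
  (forall i, is_derive x 1 (f i) (df i)) ->
  is_derive x 1 (fun y => \sum_(i <- r | P i) f i y) (\sum_(i <- r | P i) df i).
Proof.
move=> fd; elim: r => [|i r IH].
  by under eq_fun do rewrite big_nil; rewrite big_nil; exact: is_derive_cst.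
under eq_fun do rewrite big_cons; rewrite big_cons; case: (P i) => //.
exact: is_deriveD.
Qed.

Lemma derivable_bigprod (R : realType) (I : Type) (r : seq I) (P : pred I)
    (f : I -> R -> R) (x : R) :
  (forall i, derivable (f i) x 1) ->
  derivable (fun y => \prod_(i <- r | P i) f i y) x 1.
Proof.
move=> fd; elim: r => [|i r IH].
  by under eq_fun do rewrite big_nil; exact: derivable_cst.
under eq_fun do rewrite big_cons; case: (P i) => //; exact: derivableM.
Qed.

Lemma derivable_det (R : realType) n (G : R -> 'M[R]_n) (x : R) :
  (forall i j, derivable (fun y => G y i j) x 1) ->
  derivable (fun y => \det (G y)) x 1.
Proof.
move=> Gd; rewrite /determinant.
pose f (s : {perm 'I_n}) (y : R) := (-1) ^+ s * \prod_i G y i (s i).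
have fd s : derivable (f s) x 1.
  apply: derivableM; first exact: derivable_cst.
  by apply: derivable_bigprod => i; exact: Gd.
have h := @is_derive_bigsum R _ (index_enum {perm 'I_n}) xpredT f _ x
  (fun s => derivableP (fd s)).
exact: (@ex_derive _ _ _ _ _ _ _ h).
Qed.

Lemma derivable_adj (R : realType) n (G : R -> 'M[R]_n) (x : R) :
  (forall i j, derivable (fun y => G y i j) x 1) ->
  forall i j, derivable (fun y => (\adj (G y)) i j) x 1.
Proof.
move=> Gd i j; under eq_fun do rewrite mxE.
apply: derivableM; first exact: derivable_cst.
apply: derivable_det => k l; under eq_fun do rewrite !mxE; exact: Gd.
Qed.

(** The solution [W] of [W *m G = w] by Cramer's formula.  Unlike [invmx], which
    is defined by cases, this total expression is visibly differentiable in [w]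
    and [G] wherever [\det G] does not vanish. *)
Definition solution_row (R : realType) n (w : 'rV[R]_n) (G : 'M[R]_n) :=
  w *m ((\det G)^-1 *: \adj G).

Lemma solution_rowE (R : realType) n (w : 'rV[R]_n) (G : 'M[R]_n) :
  G \in unitmx -> solution_row w G = w *m invmx G.
Proof. by rewrite /solution_row /invmx => ->. Qed.

Lemma solution_rowK (R : realType) n (w : 'rV[R]_n) (G : 'M[R]_n) :
  \det G != 0 -> solution_row w G *m G = w.
Proof.
move=> dG; have uG : G \in unitmx by rewrite unitmxE unitfE.
by rewrite solution_rowE// mulmxKV.
Qed.

(** The equation satisfied by [dW] is the derivative of [W *m G = w].  As that
    identity may fail where [\det G] vanishes, it is differentiated after
    multiplication by [\det G], which makes it hold everywhere. *)
Lemma is_derive_solution_row (R : realType) n (w : R -> 'rV[R]_n)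
    (G : R -> 'M[R]_n) (dw : 'rV[R]_n) (dG : 'M[R]_n) (x : R) :
  \det (G x) != 0 ->
  (forall j, is_derive x 1 (fun y => w y 0 j) (dw 0 j)) ->
  (forall i j, is_derive x 1 (fun y => G y i j) (dG i j)) ->
  exists2 dW : 'rV[R]_n,
    forall j, is_derive x 1 (fun y => solution_row (w y) (G y) 0 j) (dW 0 j) &
    dW *m G x + solution_row (w x) (G x) *m dG = dw.
Proof.
move=> dx wd Gd.
have Gd' i j : derivable (fun y => G y i j) x 1.
  exact: (@ex_derive _ _ _ _ _ _ _ (Gd i j)).
have detd := derivable_det Gd'.
pose W y := solution_row (w y) (G y).
have Wd j : derivable (fun y => W y 0 j) x 1.
  under eq_fun do rewrite mxE.
  pose f k y := w y 0 k * ((\det (G y))^-1 *: \adj (G y)) k j.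
  have fd k : derivable (f k) x 1.
    rewrite /f; under eq_fun do rewrite mxE.
    apply: derivableM; first exact: (@ex_derive _ _ _ _ _ _ _ (wd k)).
    apply: derivableM; last exact: derivable_adj.
    exact: derivableV.
  have h := @is_derive_bigsum R _ (index_enum 'I_n) xpredT f _ x
    (fun k => derivableP (fd k)).
  exact: (@ex_derive _ _ _ _ _ _ _ h).
pose dW : 'rV[R]_n := \row_j ('D_1 (fun y => W y 0 j) x).
have WdW j : is_derive x 1 (fun y => W y 0 j) (dW 0 j).
  by rewrite mxE; exact: derivableP.
exists dW => //; apply/rowP => k.
pose F y := \sum_j W y 0 j * G y j k - w y 0 k.
have Fd : is_derive x 1 F
    (\sum_j (dW 0 j * G x j k + W x 0 j * dG j k) - dw 0 k).
  have d1 : is_derive x 1 (fun y => \sum_j W y 0 j * G y j k)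
      (\sum_j (dW 0 j * G x j k + W x 0 j * dG j k)).
    by apply: is_derive_bigsum => j; exact: is_derive_mul.
  exact: is_deriveB d1 (wd k).
have F0 y : \det (G y) != 0 -> F y = 0.
  by move=> dy; rewrite /F -[in X in _ - X](solution_rowK (w y) dy) mxE subrr.
have dF0 : (fun y => \det (G y) * F y) = cst 0.
  apply/funext => y; have [->|dy] := eqVneq (\det (G y)) 0; first by rewrite mul0r.
  by rewrite F0// mulr0.
have := is_derive_mul (derivableP detd) Fd; rewrite dF0 => -[_].
rewrite derive_cst F0// mulr0 add0r => /esym/eqP.
rewrite mulf_eq0 (negbTE dx)/= subr_eq0 => /eqP <-.
by rewrite !mxE -big_split.
Qed.

(** * The transformed operator *)

Lemma is_derive_comp_scale (R : realType) (f : R -> R) (l d x : R) :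
  is_derive (l * x) 1 f d -> is_derive x 1 (fun y => f (l * y)) (l * d).
Proof.
move=> fd.
have dl : is_derive x 1 (fun y : R => l * y) l.
  have := is_derive_mul (is_derive_cst l x 1) (is_derive_id x 1).
  by rewrite mul0r add0r mulr1.
by have := @is_derive1_comp _ f (fun y : R => l * y) x d l fd dl; rewrite mulrC.
Qed.

Lemma norm_dot_le (R : realType) (I : finType) (f g : I -> R) (c : R) :
  (forall i, `|f i| <= 1) -> (forall i, `|g i| <= c) ->
  `|\sum_i f i * g i| <= #|I|%:R * c.
Proof.
move=> f1 gc; apply: le_trans (ler_norm_sum _ _ _) _.
rewrite mulr_natl -sumr_const; apply: ler_sum => i _.
by rewrite normrM (le_trans (ler_wpM2r _ (f1 i)))// mul1r.
Qed.

(** The diagonal contributes nothing, as [0^-1 = 0]. *)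
Definition inverse_gap_sum (R : realType) N (lam : 'I_N -> R) :=
  \sum_i \sum_j `|lam j - lam i|^-1.

(** The Wronskian of two unit vectors of the plane is at most [1] (Lagrange's
    identity). *)
Lemma wronskian_sum_le (R : realType) N (lam u v : 'I_N -> R) k :
  (forall j, u j ^+ 2 + v j ^+ 2 = 1) ->
  \sum_(i | i != k) `|(v i * u k - u i * v k) / (lam k - lam i)| <=
  inverse_gap_sum lam.
Proof.
move=> uv1; rewrite /inverse_gap_sum.
rewrite exchange_big/= [leRHS](bigD1 k)//= -[leLHS]addr0 lerD//; last first.
  by apply: sumr_ge0 => i _; apply: sumr_ge0 => j _; rewrite invr_ge0.
rewrite [leRHS](bigD1 k)//= -[leLHS]add0r lerD ?invr_ge0//.
apply: ler_sum => i ik; rewrite normrM normfV ler_piMl ?invr_ge0//.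
rewrite -(@ler_pXn2r _ 2) ?nnegrE// real_normK ?num_real// expr1n.
rewrite -[leRHS](mulr1 1) -{1}(uv1 i) -(uv1 k) -subr_ge0.
have -> : (u i ^+ 2 + v i ^+ 2) * (u k ^+ 2 + v k ^+ 2) -
    (v i * u k - u i * v k) ^+ 2 = (u i * u k + v i * v k) ^+ 2 by ring.
exact: sqr_ge0.
Qed.

Section DoubleCommutation.
Variables (R : realType) (N : nat) (lam a b D : 'I_N -> R).

(** The solution of [L_{0,0} (u, v)^T = lam j (u, v)^T] with initial value
    [(a j, b j)]. *)
Definition free_u (j : 'I_N) (x : R) : R :=
  a j * cos (lam j * x) + b j * sin (lam j * x).
Definition free_v (j : 'I_N) (x : R) : R :=
  b j * cos (lam j * x) - a j * sin (lam j * x).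
Definition free_u_row (x : R) : 'rV[R]_N := \row_j free_u j x.
Definition free_v_row (x : R) : 'rV[R]_N := \row_j free_v j x.
(** The matrix [G] of the double commutation, an antiderivative of [Phi^T Phi] by
    [is_derive_gram].  On the diagonal the quotient is [0], as [0^-1 = 0], and the
    term [D i + x] remains. *)
Definition gram (x : R) : 'M[R]_N :=
  \matrix_(i, j) ((i == j)%:R * (D i + x) +
    (free_v i x * free_u j x - free_u i x * free_v j x) / (lam j - lam i)).
(** The two rows of [Psi = Phi G^-1]. *)
Definition eig_u_row (x : R) := solution_row (free_u_row x) (gram x).
Definition eig_v_row (x : R) := solution_row (free_v_row x) (gram x).
Definition eig_u (j : 'I_N) (x : R) : R := eig_u_row x 0 j.
Definition eig_v (j : 'I_N) (x : R) : R := eig_v_row x 0 j.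
(** The entries of the symmetric matrix [K = Phi G^-1 Phi^T]; the off-diagonal
    one is written in its two forms in [kernel_symmetric].  The potentials
    [pot_p] and [pot_q] are then read off [Q = J K - K J]. *)
Definition kernel_uu (x : R) := \sum_j eig_u j x * free_u j x.
Definition kernel_uv (x : R) := \sum_j eig_u j x * free_v j x.
Definition kernel_vv (x : R) := \sum_j eig_v j x * free_v j x.
Definition pot_p (x : R) := 2 * kernel_uv x.
Definition pot_q (x : R) := kernel_uu x - kernel_vv x.

Lemma is_derive_free_u (x : R) j :
  is_derive x 1 (free_u j) (lam j * free_v j x).
Proof.
have dc := is_derive_comp_scale (is_derive_cos (lam j * x)).
have ds := is_derive_comp_scale (is_derive_sin (lam j * x)).
have h := is_deriveD (is_derive_mul (is_derive_cst (a j) x 1) dc)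
  (is_derive_mul (is_derive_cst (b j) x 1) ds).
by apply: is_derive_eq h _; rewrite /free_v /cst/=; ring.
Qed.

Lemma is_derive_free_v (x : R) j :
  is_derive x 1 (free_v j) (- lam j * free_u j x).
Proof.
have dc := is_derive_comp_scale (is_derive_cos (lam j * x)).
have ds := is_derive_comp_scale (is_derive_sin (lam j * x)).
have h := is_deriveB (is_derive_mul (is_derive_cst (b j) x 1) dc)
  (is_derive_mul (is_derive_cst (a j) x 1) ds).
by apply: is_derive_eq h _; rewrite /free_u /cst/=; ring.
Qed.

Hypothesis lam_inj : injective lam.
Hypothesis ab1 : forall j, a j ^+ 2 + b j ^+ 2 = 1.

Lemma free_norm (x : R) j : free_u j x ^+ 2 + free_v j x ^+ 2 = 1.
Proof.
by rewrite -[RHS](ab1 j) -[RHS]mulr1 -(cos2Dsin2 (lam j * x)) /free_u /free_v; ring.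
Qed.

Lemma is_derive_gram (x : R) i j :
  is_derive x 1 (fun y => gram y i j)
    (((free_u_row x)^T *m free_u_row x + (free_v_row x)^T *m free_v_row x) i j).
Proof.
rewrite !mxE !big_ord1 !mxE.
under eq_fun do rewrite mxE.
have du k := is_derive_free_u x k; have dv k := is_derive_free_v x k.
have d1 : is_derive x 1 (fun y : R => (i == j)%:R * (D i + y)) (i == j)%:R.
  have dD := is_deriveD (is_derive_cst (D i) x 1) (is_derive_id x 1).
  apply: is_derive_eq (is_derive_mul (is_derive_cst ((i == j)%:R : R) x 1) dD) _.
  by rewrite mul0r !add0r mulr1.
have d2 := is_deriveB (is_derive_mul (dv i) (du j)) (is_derive_mul (du i) (dv j)).
have d3 := is_derive_mul d2 (is_derive_cst ((lam j - lam i)^-1) x 1).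
apply: is_derive_eq (is_deriveD d1 d3) _.
rewrite mulr0 addr0 /cst.
have [<-|ij] := eqVneq i j.
  by rewrite subrr invr0 mulr0 addr0 -(free_norm x i) !expr2.
have l0 : lam j - lam i != 0 by rewrite subr_eq0 (inj_eq lam_inj) eq_sym.
by rewrite add0r; field.
Qed.

Lemma tr_gram (x : R) : (gram x)^T = gram x.
Proof.
apply/matrixP => i j; rewrite !mxE.
have [->//|ij] := eqVneq i j.
have l0 : lam j - lam i != 0 by rewrite subr_eq0 (inj_eq lam_inj) eq_sym.
have l1 : lam i - lam j != 0 by rewrite subr_eq0 (inj_eq lam_inj).
by rewrite !mul0r !add0r; field; rewrite l0 l1.
Qed.

(** This identity is the reason for the form of the off-diagonal entries of
    [gram]: it is what turns [Psi] into eigenfunctions of a local operator in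
    [eig_ode]. *)
Lemma gram_commutator (x : R) :
  gram x *m diag_mx (\row_j lam j) - diag_mx (\row_j lam j) *m gram x =
  (free_v_row x)^T *m free_u_row x - (free_u_row x)^T *m free_v_row x.
Proof.
apply/matrixP => i j; rewrite mul_mx_diag mul_diag_mx.
rewrite !mxE !big_ord1 !mxE.
have [<-|ij] := eqVneq i j; first by ring.
have l0 : lam j - lam i != 0 by rewrite subr_eq0 (inj_eq lam_inj) eq_sym.
by rewrite mul0r add0r; field.
Qed.

Hypothesis D_ge : forall j, 1 + inverse_gap_sum lam <= D j.

Lemma gram_dominant (x : R) : 0 <= x ->
  forall k, 1 + x + \sum_(i | i != k) `|gram x i k| <= gram x k k.
Proof.
move=> x0 k; rewrite [gram x k k]mxE eqxx mul1r subrr invr0 mulr0 addr0.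
rewrite addrAC lerD2r (le_trans _ (D_ge k))// lerD2l.
apply: le_trans (wronskian_sum_le lam k (free_norm x)).
apply: ler_sum => i ik; by rewrite mxE (negbTE ik) mul0r add0r.
Qed.

Lemma gram_unit (x : R) : 0 <= x -> gram x \in unitmx.
Proof.
move=> x0; apply: (@diag_dominant_unitmx _ _ _ (1 + x)); first by rewrite ltr_pwDl.
exact: gram_dominant.
Qed.

Lemma gram_det (x : R) : 0 <= x -> \det (gram x) != 0.
Proof. by move=> /gram_unit; rewrite unitmxE unitfE. Qed.

Lemma free_le1 (x : R) j : `|free_u j x| <= 1 /\ `|free_v j x| <= 1.
Proof.
split; rewrite -(@ler_pXn2r _ 2) ?nnegrE// real_normK ?num_real// expr1n
  -(free_norm x j) ?lerDl ?lerDr sqr_ge0//.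
Qed.

Lemma eig_le (x : R) j : 0 <= x ->
  `|eig_u j x| <= N%:R / (1 + x) /\ `|eig_v j x| <= N%:R / (1 + x).
Proof.
move=> x0; have x1 : 0 < 1 + x by rewrite ltr_pwDl.
have H := diag_dominant_invmx x1 (gram_dominant x0).
rewrite /eig_u /eig_v /eig_u_row /eig_v_row !solution_rowE ?gram_unit// !mxE.
rewrite -[X in X%:R](card_ord N).
split; apply: norm_dot_le => [i|i]; rewrite ?mxE//;
  by case: (free_le1 x i).
Qed.

Lemma kernel_symmetric (x : R) : 0 <= x ->
  \sum_j eig_v j x * free_u j x = kernel_uv x.
Proof.
move=> /gram_det d0.
have uG := solution_rowK (free_u_row x) d0.
have vG := solution_rowK (free_v_row x) d0.
have E : eig_u_row x *m (free_v_row x)^T = (eig_v_row x *m (free_u_row x)^T)^T.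
  rewrite trmx_mul trmxK -[in LHS]vG trmx_mul tr_gram mulmxA.
  by rewrite [_ *m gram x]uG.
have dotE (z w : 'rV[R]_N) (w' : 'I_N -> R) :
    w = \row_j w' j -> (z *m w^T) 0 0 = \sum_j z 0 j * w' j.
  by move=> ->; rewrite mxE; apply: eq_bigr => j _; rewrite !mxE.
rewrite /kernel_uv -(dotE (eig_u_row x) (free_v_row x))// E mxE.
by rewrite (dotE _ _ (fun j => free_u j x)).
Qed.

(** Both sides are compared after multiplication by the invertible matrix [G].
    On the left [dU *m G = u' - U *m G'], where [G' = u^T u + v^T v] turns
    [U *m G'] into a combination of [u] and [v] with entries of [K] as coefficients;
    on the right [V *m L *m G] is computed by moving [L] across [G], where the
    commutator has the same effect.  Likewise for [dV]. *)
Lemma eig_ode (x : R) : 0 <= x ->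
  forall j, is_derive x 1 (eig_u j)
     (lam j * eig_v j x - pot_q x * eig_u j x - pot_p x * eig_v j x) /\
   is_derive x 1 (eig_v j)
     (- lam j * eig_u j x - pot_p x * eig_u j x + pot_q x * eig_v j x).
Proof.
move=> x0 j; have d0 := gram_det x0.
pose L := diag_mx (\row_j lam j).
have du k : is_derive x 1 (fun y => free_u_row y 0 k) ((free_v_row x *m L) 0 k).
  under eq_fun do rewrite mxE; rewrite mul_mx_diag !mxE mulrC; exact: is_derive_free_u.
have dv k : is_derive x 1 (fun y => free_v_row y 0 k) ((- (free_u_row x *m L)) 0 k).
  under eq_fun do rewrite mxE; rewrite mul_mx_diag !mxE mulrC -mulNr.
  exact: is_derive_free_v.
have [dU dUe dUG] := is_derive_solution_row d0 du (is_derive_gram x).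
have [dV dVe dVG] := is_derive_solution_row d0 dv (is_derive_gram x).
have uG : eig_u_row x *m gram x = free_u_row x := solution_rowK (free_u_row x) d0.
have vG : eig_v_row x *m gram x = free_v_row x := solution_rowK (free_v_row x) d0.
have dotE (z : 'rV[R]_N) (w' : 'I_N -> R) (c : R) : \sum_j z 0 j * w' j = c ->
    z *m (\row_j w' j)^T = c%:M.
  move=> <-; apply/matrixP => k l; rewrite !ord1 mxE [RHS]mxE eqxx mulr1n.
  by apply: eq_bigr => i _; rewrite !mxE.
have Uu : eig_u_row x *m (free_u_row x)^T = (kernel_uu x)%:M by exact: dotE.
have Uv : eig_u_row x *m (free_v_row x)^T = (kernel_uv x)%:M by exact: dotE.
have Vu : eig_v_row x *m (free_u_row x)^T = (kernel_uv x)%:M.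
  by apply: dotE; exact: kernel_symmetric.
have Vv : eig_v_row x *m (free_v_row x)^T = (kernel_vv x)%:M by exact: dotE.
have LG : L *m gram x = gram x *m L -
    ((free_v_row x)^T *m free_u_row x - (free_u_row x)^T *m free_v_row x).
  by rewrite -gram_commutator opprB addrC subrK.
have Ginj (z w : 'rV[R]_N) : z *m gram x = w *m gram x -> z = w.
  by move=> /(congr1 (mulmx^~ (invmx (gram x)))); rewrite !mulmxK ?gram_unit.
have dUE : dU = eig_v_row x *m L - pot_q x *: eig_u_row x - pot_p x *: eig_v_row x.
  have dG : dU *m gram x = free_v_row x *m L -
      (kernel_uu x *: free_u_row x + kernel_uv x *: free_v_row x).
    rewrite -dUG -/(eig_u_row x) mulmxDr !mulmxA.
    by rewrite Uu Uv !mul_scalar_mx addrK.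
  apply: Ginj; rewrite dG.
  rewrite !mulmxBl -!scalemxAl uG vG -mulmxA LG !mulmxBr !mulmxA vG Vu Vv.
  rewrite !mul_scalar_mx /pot_q /pot_p; apply/rowP => i.
  by rewrite !mxE; ring.
have dVE : dV = - (eig_u_row x *m L) - pot_p x *: eig_u_row x + pot_q x *: eig_v_row x.
  have dG : dV *m gram x = - (free_u_row x *m L) -
      (kernel_uv x *: free_u_row x + kernel_vv x *: free_v_row x).
    rewrite -dVG -/(eig_v_row x) mulmxDr !mulmxA.
    by rewrite Vu Vv !mul_scalar_mx addrK.
  apply: Ginj; rewrite dG.
  rewrite mulmxDl mulmxBl mulNmx -!scalemxAl uG vG -mulmxA LG !mulmxBr !mulmxA uG Uu Uv.
  rewrite !mul_scalar_mx /pot_q /pot_p; apply/rowP => i.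
  by rewrite !mxE; ring.
split.
- apply: is_derive_eq (dUe j) _; rewrite dUE mul_mx_diag /eig_u /eig_v.
  by move: (eig_u_row x) (eig_v_row x) => U V; rewrite !mxE mulrC.
- apply: is_derive_eq (dVe j) _; rewrite dVE mul_mx_diag /eig_u /eig_v.
  by move: (eig_u_row x) (eig_v_row x) => U V; rewrite !mxE mulrC mulNr.
Qed.

Lemma kernel_le (x : R) : 0 <= x ->
  [/\ `|kernel_uu x| <= N%:R * (N%:R / (1 + x)), `|kernel_uv x| <= N%:R * (N%:R / (1 + x))
    & `|kernel_vv x| <= N%:R * (N%:R / (1 + x))].
Proof.
move=> x0; rewrite /kernel_uu /kernel_uv /kernel_vv -[X in X%:R * _](card_ord N).
have e j := eig_le j x0; have f j := free_le1 x j.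
by split; under eq_bigr do rewrite mulrC;
  apply: norm_dot_le => j; case: (e j); case: (f j).
Qed.

Lemma potential_le (x : R) : 0 <= x ->
  Num.sqrt (pot_p x ^+ 2 + pot_q x ^+ 2) <= 4 * N%:R ^+ 2 / (1 + x) /\
  (`|pot_p x| <= 4 * N%:R ^+ 2 / (1 + x) /\
   `|pot_q x| <= 4 * N%:R ^+ 2 / (1 + x)).
Proof.
move=> x0; have [k1 k2 k3] := kernel_le x0.
set c := N%:R * _ in k1 k2 k3.
have -> : 4 * N%:R ^+ 2 / (1 + x) = 4 * c by rewrite /c; ring.
have c0 : 0 <= c by apply: le_trans k1; exact: normr_ge0.
have p2 : `|pot_p x| <= 2 * c.
  by rewrite /pot_p normrM ger0_norm// ler_pM2l.
have q2 : `|pot_q x| <= 2 * c.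
  by apply: le_trans (ler_normB _ _) _; lra.
split; last by lra.
have c4 : 0 <= 4 * c by rewrite mulr_ge0.
rewrite -[leRHS](ger0_norm c4) -sqrtr_sqr ler_wsqrtr//.
rewrite -(real_normK (num_real (pot_p x))) -(real_normK (num_real (pot_q x))).
have := normr_ge0 (pot_p x); have := normr_ge0 (pot_q x).
move: `|pot_p x| `|pot_q x| p2 q2 => p q p2 q2 p0 q0.
by nra.
Qed.

(** The unknowns of the polynomial system: the flags select transformed or
    free solutions, and the first or the second component. *)
Definition gens (i : bool * bool * 'I_N) : R -> R :=
  let: (e, s, j) := i in
  if e then (if s then eig_u j else eig_v j)
  else (if s then free_u j else free_v j).

Lemma gens_polynomial :
  [/\ forall j, polynomial_in gens (eig_u j), forall j, polynomial_in gens (eig_v j),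
   polynomial_in gens pot_p & polynomial_in gens pot_q].
Proof.
have gu j : polynomial_in gens (eig_u j) by exact: (PolyVar gens (true, true, j)).
have gv j : polynomial_in gens (eig_v j) by exact: (PolyVar gens (true, false, j)).
have fu j : polynomial_in gens (free_u j) by exact: (PolyVar gens (false, true, j)).
have fv j : polynomial_in gens (free_v j) by exact: (PolyVar gens (false, false, j)).
split=> //.
- apply: PolyMul; first exact: PolyCst.
  by apply: polynomial_in_sum => j; exact: PolyMul.
- by apply: polynomial_in_sub; apply: polynomial_in_sum => j; exact: PolyMul.
Qed.

Lemma gens_derive (i : bool * bool * 'I_N) : exists2 dg, polynomial_in gens dg &
  forall x : R, 0 <= x -> is_derive x 1 (gens i) (dg x).
Proof.
have [gu gv gp gq] := gens_polynomial.
have fu j : polynomial_in gens (free_u j) by exact: (PolyVar gens (false, true, j)).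
have fv j : polynomial_in gens (free_v j) by exact: (PolyVar gens (false, false, j)).
case: i => [[[] []] j].
- exists (fun x => lam j * eig_v j x - pot_q x * eig_u j x - pot_p x * eig_v j x).
    by do 2?[apply: polynomial_in_sub]; apply: PolyMul => //; exact: PolyCst.
  by move=> x x0; case: (eig_ode x0 j).
- exists (fun x => - lam j * eig_u j x - pot_p x * eig_u j x + pot_q x * eig_v j x).
    apply: PolyAdd; last exact: PolyMul.
    by apply: polynomial_in_sub; apply: PolyMul => //; exact: PolyCst.
  by move=> x x0; case: (eig_ode x0 j).
- exists (fun x => lam j * free_v j x); first by apply: PolyMul => //; exact: PolyCst.
  by move=> x _; exact: is_derive_free_u.
- exists (fun x => - lam j * free_u j x); first by apply: PolyMul => //; exact: PolyCst.
  by move=> x _; exact: is_derive_free_v.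
Qed.

Lemma potential_smooth : hl_smooth pot_p /\ hl_smooth pot_q.
Proof.
have [_ _ gp gq] := gens_polynomial.
by split; exact: (polynomial_in_hl_smooth gens_derive).
Qed.

Lemma potential_L2 : hl_L2 pot_p /\ hl_L2 pot_q.
Proof.
have [_ _ gp gq] := gens_polynomial.
have [dp _ hp] := polynomial_in_derive gens_derive gp.
have [dq _ hq] := polynomial_in_derive gens_derive gq.
split.
- by apply: (hl_L2_decay hp) => x x0; case: (potential_le x0) => _ [hp' hq']; eassumption.
- by apply: (hl_L2_decay hq) => x x0; case: (potential_le x0) => _ [hp' hq']; eassumption.
Qed.

Lemma eig_L2 j : hl_L2 (eig_u j) /\ hl_L2 (eig_v j).
Proof.
split.
- by apply: (hl_L2_decay (fun x x0 => (eig_ode x0 j).1)) => x x0;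
    case: (eig_le j x0) => hu hv; eassumption.
- by apply: (hl_L2_decay (fun x x0 => (eig_ode x0 j).2)) => x x0;
    case: (eig_le j x0) => hu hv; eassumption.
Qed.

Lemma eig_dirac j : (eig_u j 0, eig_v j 0) != (0, 0) ->
  dirac_eigensolution pot_p pot_q (lam j) (eig_u j) (eig_v j).
Proof.
move=> n0.
have H x (x0 : 0 <= x) := eig_ode x0 j.
split.
- by move=> x x0; case: (is_derive_hl x0 (H x x0).1).
- by move=> x x0; case: (is_derive_hl x0 (H x x0).2).
- move=> x x0; rewrite /dirac_op.
  have [_ ->] := is_derive_hl x0 (H x x0).1.
  have [_ ->] := is_derive_hl x0 (H x x0).2.
  by congr (_, _); ring.
- by exists 0.
Qed.

End DoubleCommutation.

(** * Prescribing the boundary values *)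

(** A matrix with constant diagonal [d] that exceeds the off-diagonal column
    sums by [c] has inverse [d^-1] times the identity up to an error [s / c]:
    read [B^-1 *m B = 1] entrywise and bound the off-diagonal part by
    [diag_dominant_invmx]. *)
Lemma near_identity_inverse (R : realType) N (B : 'M[R]_N) (d s c : R) :
  0 < c -> 0 <= s -> d = s + c ->
  (forall k, B k k = d) -> (forall k, \sum_(i | i != k) `|B i k| <= s) ->
  B \in unitmx /\ forall i k, `|d * invmx B i k - (i == k)%:R| <= s / c.
Proof.
move=> c0 s0 dE Bd Bs.
have dom k : c + \sum_(i | i != k) `|B i k| <= B k k.
  by rewrite Bd dE addrC lerD2r.
have uB := diag_dominant_unitmx c0 dom; split=> // i k.
have := congr1 (fun M : 'M[R]_N => M i k) (mulVmx uB).
rewrite !mxE (bigD1 k)//= Bd => <-.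
rewrite mulrC opprD addNKr normrN.
apply: le_trans (ler_norm_sum _ _ _) _.
rewrite mulrC; apply: le_trans (ler_wpM2l _ (Bs k)); last by rewrite invr_ge0 ltW.
rewrite mulr_sumr; apply: ler_sum => j _; rewrite normrM ler_wpM2r//.
exact: diag_dominant_invmx.
Qed.

(** With [A = B^-1] and [P, Q] the rows of [E A], the normalised initial values
    are [(P j, Q j) / r j] with [r j] the length of [(P j, Q j)], and [gram 0] is [A]
    conjugated by the diagonal matrix of the [r j].  As [d *: A] is nearly the
    identity, [d * r j] is of the order of [1] and [D j = A j j / r j ^+ 2] is of the order
    of [d], hence as large as desired. *)
Lemma prescribed_boundary (R : realType) N (lam cs sn : 'I_N -> R) :
  injective lam -> (forall j, cs j ^+ 2 + sn j ^+ 2 = 1) ->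
  exists a b D r : 'I_N -> R,
  [/\ forall j, a j ^+ 2 + b j ^+ 2 = 1,
      forall j, 1 + inverse_gap_sum lam <= D j,
      forall j, 0 < r j
    & forall j, eig_u lam a b D j 0 = r j * cs j /\
                eig_v lam a b D j 0 = r j * sn j].
Proof.
move=> lam_inj cs1.
pose S := inverse_gap_sum lam.
have S0 : 0 <= S by apply: sumr_ge0 => i _; apply: sumr_ge0 => j _; rewrite invr_ge0.
pose n : R := N%:R; have n0 : 0 <= n by exact: ler0n.
(* the factor [1 + n] makes the error of a column of [d *: E A], at most
   [n * (S / c)], small; the factor [8 * (1 + S)] gives [1 + S <= D j] *)
pose c := 8 * (1 + S) * (1 + n).
have c0 : 0 < c by rewrite /c !mulr_gt0//; lra.
pose d := S + c.
have d0 : 0 < d by rewrite /d; lra.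
pose B : 'M[R]_N := \matrix_(i, j) ((i == j)%:R * d -
  (sn i * cs j - cs i * sn j) / (lam j - lam i)).
have Bd k : B k k = d by rewrite mxE eqxx mul1r subrr invr0 mulr0 subr0.
have Bs k : \sum_(i | i != k) `|B i k| <= S.
  apply: le_trans (wronskian_sum_le lam k cs1).
  by apply: ler_sum => i ik; rewrite mxE (negbTE ik) mul0r sub0r normrN.
have BT : B^T = B.
  apply/matrixP => i j; rewrite !mxE; have [->//|ij] := eqVneq i j.
  have l0 : lam j - lam i != 0 by rewrite subr_eq0 (inj_eq lam_inj) eq_sym.
  have l1 : lam i - lam j != 0 by rewrite subr_eq0 (inj_eq lam_inj).
  by rewrite !mul0r !sub0r; field; rewrite l0 l1.
have [uB AI] := near_identity_inverse c0 S0 (erefl d) Bd Bs.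
pose A := invmx B.
have AT : A^T = A by rewrite /A trmx_inv BT.
pose cr : 'rV[R]_N := \row_j cs j; pose sr : 'rV[R]_N := \row_j sn j.
pose P j := (cr *m A) 0 j; pose Q j := (sr *m A) 0 j.
have nS : n * (S / c) <= 1 / 8.
  rewrite mulrA ler_pdivrMr// /c; nra.
have Pnear (f : 'I_N -> R) j : (forall i, `|f i| <= 1) ->
    `|d * ((\row_i f i) *m A) 0 j - f j| <= 1 / 8.
  move=> f1; apply: le_trans nS.
  have -> : d * ((\row_i f i) *m A) 0 j - f j =
      \sum_i f i * (d * A i j - (i == j)%:R).
    under eq_bigr do rewrite mulrBr; rewrite sumrB; congr (_ - _).
      by rewrite mxE mulr_sumr; apply: eq_bigr => i _; rewrite mxE mulrCA.
    rewrite (bigD1 j)//= eqxx mulr1 big1 ?addr0// => i ij.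
    by rewrite (negbTE ij) mulr0.
  by rewrite /n -[X in X%:R * _](card_ord N); apply: norm_dot_le => // i; exact: AI.
have cs_le j : `|cs j| <= 1 /\ `|sn j| <= 1.
  split; rewrite -(@ler_pXn2r _ 2) ?nnegrE// real_normK ?num_real// expr1n
    -(cs1 j) ?lerDl ?lerDr sqr_ge0//.
have PQ j : 1 / 4 <= (d * P j) ^+ 2 + (d * Q j) ^+ 2 <= 4.
  have := Pnear cs j (fun i => (cs_le i).1); rewrite -/(P j) ler_norml => /andP[p1 p2].
  have := Pnear sn j (fun i => (cs_le i).2); rewrite -/(Q j) ler_norml => /andP[q1 q2].
  have sq (p x : R) : - (1 / 8) <= p - x -> p - x <= 1 / 8 ->
      x ^+ 2 / 2 - 1 / 64 <= p ^+ 2 <= 2 * x ^+ 2 + 1 / 32.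
    move=> h1 h2.
    have e2 : (p - x) ^+ 2 <= 1 / 64 by nra.
    have := sqr_ge0 (x + 2 * (p - x)); have := sqr_ge0 (x - (p - x)).
    by move=> *; apply/andP; split; nra.
  have /andP[P1 P2] := sq _ _ p1 p2; have /andP[Q1 Q2] := sq _ _ q1 q2.
  by have := cs1 j; move=> ?; apply/andP; split; lra.
have PQ0 j : 0 < P j ^+ 2 + Q j ^+ 2.
  have /andP[+ _] := PQ j; rewrite !exprMn -mulrDr => h.
  by rewrite -(@pmulr_rgt0 _ (d ^+ 2)) ?exprn_gt0//; lra.
pose r j := Num.sqrt (P j ^+ 2 + Q j ^+ 2).
have r0 j : 0 < r j by rewrite sqrtr_gt0.
have r2 j : r j ^+ 2 = P j ^+ 2 + Q j ^+ 2 by rewrite sqr_sqrtr// ltW.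
have rn0 j : r j != 0 by rewrite gt_eqF.
pose a j := P j / r j; pose b j := Q j / r j; pose D j := A j j / r j ^+ 2.
have ab1 j : a j ^+ 2 + b j ^+ 2 = 1.
  by rewrite /a /b !expr_div_n -mulrDl -r2 divff// expf_neq0.
have D_ge j : 1 + inverse_gap_sum lam <= D j.
  rewrite /D ler_pdivlMr ?exprn_gt0// -/S r2.
  have /andP[_] := PQ j; rewrite !exprMn -mulrDr => h.
  have := AI j j; rewrite eqxx ler_norml => /andP[h' _].
  have Sc : S / c <= 1 / 8 by rewrite ler_pdivrMr// /c; nra.
  have dA : 7 / 8 <= d * A j j by rewrite /A /=; move: h' => /=; lra.
  rewrite -(@ler_pM2l _ (d ^+ 2)) ?exprn_gt0// mulrCA.
  apply: (@le_trans _ _ ((1 + S) * 4)); first by rewrite ler_wpM2l//; lra.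
  rewrite expr2 -mulrA.
  apply: (@le_trans _ _ (d * (7 / 8))); last by rewrite ler_pM2l.
  by rewrite /d /c; nra.
exists a, b, D, r; split=> // j.
pose L := diag_mx (\row_j lam j).
have comB : L *m B - B *m L = sr^T *m cr - cr^T *m sr.
  apply/matrixP => i k; rewrite mul_mx_diag mul_diag_mx !mxE !big_ord1 !mxE.
  have [<-|ik] := eqVneq i k; first by ring.
  have l0 : lam k - lam i != 0 by rewrite subr_eq0 (inj_eq lam_inj) eq_sym.
  by rewrite mul0r sub0r; field.
(* obtained from [comB] by multiplying with [A] on both sides *)
have comA : A *m L - L *m A = (sr *m A)^T *m (cr *m A) - (cr *m A)^T *m (sr *m A).
  have -> : (sr *m A)^T *m (cr *m A) - (cr *m A)^T *m (sr *m A) =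
      A *m (sr^T *m cr - cr^T *m sr) *m A.
    by rewrite mulmxBr mulmxBl !trmx_mul AT !mulmxA.
  rewrite -comB mulmxBr mulmxBl !mulmxA mulVmx// mul1mx.
  by rewrite -!mulmxA mulmxV// mulmx1.
(* off the diagonal, [comA] determines the entries of [A] *)
have gramA i k : r i * gram lam a b D 0 i k * r k = A i k.
  have ri := rn0 i; have rk := rn0 k.
  rewrite mxE /free_u /free_v !mulr0 cos0 sin0 !mulr1 !mulr0 !addr0 !subr0.
  have [<-|ik] := eqVneq i k.
    by rewrite subrr invr0 mulr0 addr0 mul1r /D; field.
  have l0 : lam k - lam i != 0 by rewrite subr_eq0 (inj_eq lam_inj) eq_sym.
  have := congr1 (fun M : 'M[R]_N => M i k) comA.
  rewrite [LHS]mxE [X in _ + X]mxE mul_mx_diag mul_diag_mx [X in X - _]mxE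
    [X in _ - X]mxE ![(\row__ _) _ _]mxE.
  rewrite [RHS]mxE [X in _ = _ + X]mxE [X in _ = X - _]mxE [X in _ = _ - X]mxE.
  rewrite !big_ord1 ![(_^T) _ _]mxE -!/(P _) -!/(Q _) => E.
  rewrite mul0r add0r /a /b.
  have -> : A i k = (A i k * lam k - lam i * A i k) / (lam k - lam i) by field.
  by rewrite E; field; rewrite l0 ri rk.
have g0 : gram lam a b D 0 \in unitmx by exact: gram_unit.
have solve (f : 'I_N -> R) (w : 'rV[R]_N) :
    (forall k, w 0 k * r k = ((\row_i f i) *m A) 0 k) ->
    solution_row w (gram lam a b D 0) 0 j = r j * f j.
  move=> wE; have -> : w = (\row_i (r i * f i)) *m gram lam a b D 0.
    apply/rowP => k; apply: (mulIf (rn0 k)); rewrite wE !mxE mulr_suml.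
    by apply: eq_bigr => i _; rewrite -gramA ![(\row__ _) _ _]mxE; ring.
  by rewrite solution_rowE// mulmxK// mxE.
split; apply: solve => k; rewrite mxE /free_u /free_v mulr0 cos0 sin0
    !mulr1 !mulr0 ?addr0 ?subr0.
- by rewrite /a divfK.
- by rewrite /b divfK.
Qed.

Theorem theorem1p3 (R : realType) (N : nat) (hN : (1 <= N)%N)
    (lambda : 'I_N -> R) (hlambda : injective lambda) :
  exists2 M : R, 0 < M &
    forall theta : 'I_N -> R, (forall j, 0 <= theta j < pi) ->
    exists p q : R -> R,
      [/\ hl_smooth p /\ hl_smooth q,
          hl_L2 p /\ hl_L2 q,
          forall x, 0 <= x -> Num.sqrt (p x ^+ 2 + q x ^+ 2) <= M / (1 + x)
        & forall j, exists u v : R -> R,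
            [/\ dirac_eigensolution p q (lambda j) u v,
                hl_L2 u /\ hl_L2 v
              & boundary_cond (theta j) u v]].
Proof.
have N0 : 0 < N%:R :> R by rewrite ltr0n.
exists (4 * N%:R ^+ 2); first by rewrite mulr_gt0// exprn_gt0.
move=> theta _.
have [a [b [D [r [ab1 D_ge r0 bc]]]]] :=
  prescribed_boundary hlambda (fun j => cos2Dsin2 (theta j)).
exists (pot_p lambda a b D), (pot_q lambda a b D); split.
- exact: potential_smooth.
- exact: potential_L2.
- by move=> x x0; case: (potential_le ab1 D_ge x0).
move=> j; exists (eig_u lambda a b D j), (eig_v lambda a b D j).
have [u0 v0] := bc j; split.
- apply: eig_dirac => //; rewrite u0 v0; apply/eqP => -[/eqP + /eqP].
  rewrite !mulf_eq0 gt_eqF//= => /eqP c0 /eqP s0.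
  by have /eqP := cos2Dsin2 (theta j); rewrite c0 s0 expr0n addr0 eq_sym oner_eq0.
- exact: eig_L2.
- by rewrite /boundary_cond u0 v0; ring.
Qed.
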